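(* Let $F_\Theta=\{f_\theta,\theta\in\Theta\}$ be a hypothesis class and $g$ a ground truth function with projection $f_{opt}=f_{\theta_{opt}}$ on the class. Assume: (1) $\theta_{opt}$ is a stable GLP of $R_g$; (2) $\theta_{opt}$ is the unique global optimum (unique minimizer of $R_g$ over $\Theta$); (3) $\lim_{n\to\infty}\hat\theta^g_n=\theta_{opt}$ in probability; (4) $F_\Theta$ is a complete space; (5) $0<\delta<\delta_{max}$, where $$\delta_{max}=\min\Big\{\min_{\theta\notin A_{\theta_0}}R_{f_{opt}}(\theta),\ \min_{\theta\notin A_{\theta_0}}R_g(\theta)-R_g(\theta_{opt})\Big\},\qquad \theta_0=\theta_{opt}.$$ Then $$\Pr\big(R_g(\hat\theta^g_n)-R_g(\theta_{opt})>\delta\big)=P_R+(1-P_R)\Pr\big(\hat\theta^g_n\notin A_{\theta_0}\mid R_{f_{opt}}(\hat\theta^{f_{opt}}_n)<\delta\big),$$ where $P_R=\Pr\big(R_{f_{opt}}(\hat\theta^{f_{opt}}_n)>\delta\big)$.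
   Context: Setting. $\mathbf X\subseteq\mathbb R^N$ is a feature space with probability distribution $\mathcal F$; samples $x^n=(x_1,\dots,x_n)$ are i.i.d. from $\mathcal F$. The ground truth is a deterministic function $g:\mathbf X\to\{0,1\}$; the hypotheses $f_\theta:\mathbf X\to\{0,1\}$, $\theta\in\Theta$, are binary. The loss is $\ell(a,b)=0$ if $a=b$ and $1$ otherwise. For a function $f:\mathbf X\to\{0,1\}$: $R_f(\theta)=\int_{\mathbf X}\ell(f(x),f_\theta(x))\,d\mathcal F(x)$, $R_f^{emp}(\theta,x^n)=\frac1n\sum_{i=1}^n\ell(f(x_i),f_\theta(x_i))$, and the ERM is $\hat\theta^f_n=\hat\theta^f(x^n)=\arg\min_{\theta\in\Theta}R_f^{emp}(\theta,x^n)$, where among several minimizers the one maximizing the true risk $R_f$ is chosen. $\theta_{opt}=\arg\min_{\theta\in\Theta}R_g(\theta)$, $f_{opt}=f_{\theta_{opt}}$ (the projection of $g$ on $F_\Theta$), and $\theta_0=\theta_{opt}$ is called the global optimum. Standing assumptions. Non-degeneracy: for every $X'\subseteq\mathbf X$ of positive probability, the conditional probability given $x\in X'$ that all values $f_\theta(x)$, $\theta\in\Theta$, coincide is $0$. Sets of positive Lebesgue measure have positive probability. GLP. $\theta\in\Theta$ is a generalized optimum point (GLP) of $R_g$ if for all $\tilde\theta\in\Theta\setminus\{\theta\}$ there is a set $\tilde X\subseteq\mathbf X$ of positive probability with $\ell(f_\theta(x),g(x))<\ell(f_{\tilde\theta}(x),g(x))$ for all $x\in\tilde X$. $\Theta_{opt}$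 is the set of GLPs. Stability. A GLP $\theta^*$ is stable if (with respect to a distance $\|\cdot\|$ on $\Theta$) there is $\epsilon>0$ such that for every $\theta$ with $\|\theta-\theta^*\|<\epsilon$, $\ell(f_{\theta^*}(x),g(x))\le\ell(f_\theta(x),g(x))$ with probability 1. Regions $A_{\theta^*}$. For $\theta^*\in\Theta_{opt}$ let $\tilde A_{\theta^*}=\{\theta\in\Theta:\Pr(\ell(f_{\theta^*}(x),g(x))\le\ell(f_\theta(x),g(x)))=1\}$. For $\theta^*\ne\theta_0$, the $A_{\theta^*}$ are obtained from the $\tilde A_{\theta^*}$ by arbitrarily assigning each intersection to one of the regions so that there is no overlap; and $A_{\theta_0}=\tilde A_{\theta_0}\setminus\bigcup_{\theta^*\in\Theta_{opt},\theta^*\neq\theta_0}A_{\theta^*}$. Completeness. $F_\Theta$ is complete if the limit of any Cauchy sequence in $\Theta$ is in $\Theta$, and the limit of any sequence $f_{\theta_m}\in F_\Theta$ such that $\int_{\mathbf X}\ell(f_{\theta_m}(x),f_{\theta_{m+1}}(x))\,d\mathcal F(x)$ has a limit (as $m\to\infty$) is in $F_\Theta$.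
   Formalization: Conditioning is on R_{f_opt}≤δ; the printed form with <δ is proved when Pr(R_{f_opt}=δ)=0. Added: the a.s. inequality defining A_{θ0} holds off one null set common to all θ in A_{θ0} (automatic if countable). The claim fails without these. *)

(* Defs.v *)
From HB Require Import structures.
From mathcomp Require Import all_boot all_order all_algebra.
From mathcomp Require Import all_classical all_reals all_analysis.

Set Implicit Arguments.
Unset Strict Implicit.
Unset Printing Implicit Defensive.

Import Order.TTheory GRing.Theory Num.Theory.
Import numFieldNormedType.Exports.

Local Open Scope classical_set_scope.
Local Open Scope ring_scope.

(* R^N with the product of the Borel sigma-algebras of R. *)
Notation Rn R N := (N.-tuple (measurableTypeR R)).

Section lebesgue_Rn.
Context {R : realType} {N : nat}.

Definition box (a b : Rn R N) : set (Rn R N) :=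
  [set x | forall i, tnth a i <= tnth x i <= tnth b i].

Definition box_volume (a b : Rn R N) : R :=
  \prod_(i < N) Num.max 0 (tnth b i - tnth a i).

(* Lebesgue outer measure on R^N: it is the N-dimensional Lebesgue measure on
   the measurable sets, the only sets it is applied to below. *)
Definition lebesgue_outer (B : set (Rn R N)) : \bar R :=
  ereal_inf [set s | exists a b : nat -> Rn R N,
    B `<=` \bigcup_k box (a k) (b k) /\
    s = (\sum_(0 <= k <oo) (box_volume (a k) (b k))%:E)%E].

End lebesgue_Rn.

Section probability.
Context {d d' : measure_display} {R : realType}.
Context {Omega : measurableType d} {T : measurableType d'}.
Variable P : probability Omega R.

Definition Pr (E : set Omega) : R := fine (P E).

Definition cond_Pr (E C : set Omega) : R := Pr (E `&` C) / Pr C.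

(* Independence of an infinite sequence: any finite product rule follows from
   the one for initial segments by taking some of the B i to be setT. *)
Definition iid (F : probability T R) (x : nat -> {RV P >-> T}) : Prop :=
  (forall i B, measurable B -> distribution P (x i) B = F B) /\
  (forall n (B : nat -> set T), (forall i, measurable (B i)) ->
    P (\bigcap_(i in `I_n) (x i @^-1` B i)) =
    (\prod_(i < n) P (x i @^-1` B i))%E).

Definition sample (x : nat -> {RV P >-> T}) (n : nat) (w : Omega) :
  n.-tuple T := [tuple x i w | i < n].

Definition cvg_in_probability {Theta : metricType R}
    (Y : nat -> Omega -> Theta) (y : Theta) : Prop :=
  forall e : R, 0 < e ->
    (fun n => Pr [set w | e < mdist (Y n w) y]) @ \oo --> (0 : R).

End probability.

Definition loss {R : realType} (a b : bool) : R := (a != b)%:R.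

Definition is_argmin {T : Type} {R : realType} (r : T -> R) (t : T) : Prop :=
  forall u, r t <= r u.

Section learning.
Context {R : realType} {N : nat}.
Variable X : set (Rn R N).
Variable F : probability (Rn R N) R.
Context {Theta : metricType R}.
(* Only the values of the classifiers on X matter. *)
Variable f : Theta -> Rn R N -> bool.

Definition risk (h : Rn R N -> bool) (t : Theta) : R :=
  \int[F]_(x in X) loss (h x) (f t x).

Definition emp_risk (h : Rn R N -> bool) (n : nat) (xs : n.-tuple (Rn R N))
    (t : Theta) : R :=
  n%:R^-1 * \sum_(i < n) loss (h (tnth xs i)) (f t (tnth xs i)).

Definition is_ERM (h : Rn R N -> bool) (n : nat)
    (th : n.-tuple (Rn R N) -> Theta) : Prop :=
  forall xs : n.-tuple (Rn R N), (forall i, X (tnth xs i)) ->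
    is_argmin (emp_risk h xs) (th xs) /\
    (forall t, is_argmin (emp_risk h xs) t -> risk h t <= risk h (th xs)).

(* Measurability of the coincidence set (automatic for countable classes) is
   what gives its conditional probabilities a meaning. *)
Definition nondegenerate_class : Prop :=
  let coincide := [set x | X x /\ forall t u, f t x = f u x] in
  measurable coincide /\
  forall X', measurable X' -> X' `<=` X -> (0 < F X')%E ->
    cond_Pr F coincide X' = 0.

Definition charges_lebesgue_positive : Prop :=
  forall B, measurable B -> B `<=` X -> (0 < lebesgue_outer B)%E ->
    (0 < F B)%E.

Section ground_truth.
Variable g : Rn R N -> bool.

Definition GLP : set Theta := [set t | forall u, u <> t ->
  exists X' : set (Rn R N), [/\ measurable X', X' `<=` X, (0 < F X')%E &
    forall x, X' x -> loss (f t x) (g x) < loss (f u x) (g x) :> R]].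

(* Pr (loss(f_t(x), g(x)) <= loss(f_u(x), g(x))) = 1. *)
Definition as_better (t u : Theta) : Prop :=
  F [set x | X x /\ loss (f t x) (g x) <= loss (f u x) (g x) :> R] = 1%E.

Definition stable_GLP (t : Theta) : Prop :=
  GLP t /\ exists2 e : R, 0 < e & forall u, mdist u t < e -> as_better t u.

Definition wide_region (t : Theta) : set Theta := [set u | as_better t u].

(* A is one of the admissible choices of regions for the optimum t0: outside
   t0 the A t partition the union of the wide regions, every point that is in
   several of them being given to exactly one. *)
Record is_regions (t0 : Theta) (A : Theta -> set Theta) : Prop := IsRegions {
  region_sub : forall t, (GLP `\ t0) t -> A t `<=` wide_region t;
  region_disjoint : trivIset (GLP `\ t0) A;
  region_cover :
    \bigcup_(t in GLP `\ t0) A t = \bigcup_(t in GLP `\ t0) wide_region t;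
  region_opt : A t0 = wide_region t0 `\` \bigcup_(t in GLP `\ t0) A t
}.

(* An infimum over the empty set is +oo. *)
Definition delta_max (t0 : Theta) (A0 : set Theta) : \bar R :=
  Order.min (ereal_inf [set (risk (f t0) t)%:E | t in ~` A0])
            (ereal_inf [set (risk g t - risk g t0)%:E | t in ~` A0]).

(* The exceptional null sets in the definition of the wide region of t0 can be
   chosen independently of t in A0. This always holds when A0 is countable.
   Without it an ERM could gain from values of the f_t on null sets. *)
Definition common_null_set (t0 : Theta) (A0 : set Theta) : Prop :=
  exists2 Z, F.-negligible Z & forall t x, A0 t -> X x -> ~ Z x ->
    loss (f t0 x) (g x) <= loss (f t x) (g x) :> R.

End ground_truth.

(* Limits of functions are taken for the pseudo-distance int loss(f, f') dF,
   so that a limit is determined only up to a null set. *)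
Definition complete_class : Prop :=
  (forall u : nat -> Theta, cauchy (u @ \oo) -> exists t : Theta, u @ \oo --> t) /\
  (forall u : nat -> Theta,
    cvg ((fun m => \int[F]_(x in X) loss (f (u m) x) (f (u m.+1) x) : R)
           @ \oo) ->
    forall h : Rn R N -> bool, measurable_fun X h ->
    (fun m => risk h (u m)) @ \oo --> (0 : R) ->
    exists t, F [set x | X x /\ f t x = h x] = 1%E).

End learning.

(* Main.v *)
(* On the region of the optimum t0, almost surely every mistake of f_t0 is also
   a mistake of f_t, so the true and the empirical risks split:
   R_g(t) = R_g(t0) + R_{f_t0}(t). Hence, when the ERM for g lands in the region,
   f_t0 is itself an empirical minimizer and the tie-breaking by the true risk
   makes "excess > delta" equivalent to
   "R_{f_t0}(ERM for f_t0) > delta". Outside the region the excess risk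
   is above delta by the choice of delta_max. So, up to a null event, the event
   "excess > delta" is the union of "R_{f_t0}(ERM for f_t0) > delta" and
   "the ERM for g misses the region". *)
Require Import Defs.
From HB Require Import structures.
From mathcomp Require Import all_boot all_order all_algebra.
From mathcomp Require Import all_classical all_reals all_analysis.
From mathcomp Require Import measurable_realfun.

Set Implicit Arguments.
Unset Strict Implicit.
Unset Printing Implicit Defensive.

Import Order.TTheory GRing.Theory Num.Theory.
Import numFieldNormedType.Exports.

Local Open Scope classical_set_scope.
Local Open Scope ring_scope.

(** * Null events and conditional probabilities *)

Section probability_lemmas.
Context {d : measure_display} {R : realType} {Omega : measurableType d}.
Variable P : probability Omega R.

Lemma probability_fineK (E : set Omega) : measurable E -> (Pr P E)%:E = P E.
Proof. by move=> mE; rewrite /Pr fineK// fin_num_measure. Qed.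

(** Both events become the same set after union with a measurable null set containing [N]. *)
Lemma Pr_eq_ae (N E1 E2 : set Omega) : P.-negligible N ->
  measurable E1 -> measurable E2 -> (forall w, ~ N w -> E1 w <-> E2 w) ->
  Pr P E1 = Pr P E2.
Proof.
move=> [M [mM M0 NM]] mE1 mE2 E12; congr fine.
rewrite -(measureU0 mE1 mM M0) -(measureU0 mE2 mM M0); congr (P _).
apply/seteqP; split=> w [Ew|Mw]; try (by right);
  by have [Mw|/(contra_not (NM w))/E12[? ?]] := pselect (M w); [right|left; auto].
Qed.

Lemma Pr_setUC (C M : set Omega) : measurable C -> measurable M ->
  Pr P (~` C `|` M) = Pr P (~` C) + (1 - Pr P (~` C)) * cond_Pr P M C.
Proof.
move=> mC mM; have mCc := measurableC mC; have mMC := measurableI _ _ mM mC.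
have -> : ~` C `|` M = ~` C `|` (M `&` C).
  apply/seteqP; split=> w /=; first by have [] := pselect (C w); tauto.
  by tauto.
have -> : Pr P (~` C `|` M `&` C) = Pr P (~` C) + Pr P (M `&` C).
  apply: EFin_inj; rewrite EFinD !probability_fineK//; last exact: measurableU.
  by rewrite measureU//; apply/seteqP; split=> w //= [] ? [].
congr (_ + _).
have -> : 1 - Pr P (~` C) = Pr P C.
  rewrite /Pr probability_setC// -[in LHS](fineK (fin_num_measure P C mC)).
  by rewrite -EFinB /= subKr.
(* If [Pr P C = 0], the quotient is multiplied by 0 whatever its value, and [M] meets [C] in a null
   set. *)
rewrite /cond_Pr; have [C0|C0] := eqVneq (Pr P C) 0; last by rewrite mulrC divfK.
rewrite C0 mul0r; apply: EFin_inj; rewrite probability_fineK//.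
by apply: (subset_measure0 mMC mC); [move=> w []|apply: etrans (esym (probability_fineK mC)) _; rewrite C0].
Qed.

End probability_lemmas.

(** * The 0-1 loss on binary labels *)

Section loss_lemmas.
Context {R : realType}.

Lemma loss_eq0 (a b : bool) : (loss a b == 0 :> R) = (a == b).
Proof. by rewrite /loss; case: a; case: b; rewrite /= ?eqxx ?oner_eq0. Qed.

Lemma loss_ge0 (a b : bool) : 0 <= loss a b :> R.
Proof. exact: ler0n. Qed.

(* Binary labels: where a classifier is no better than [b], it can differ from
   [b] only by a mistake that [b] does not make. *)
Lemma loss_split (a b c : bool) : loss b a <= loss c a :> R ->
  loss a c = loss a b + loss b c :> R.
Proof.
by rewrite /loss; case: a; case: b; case: c; rewrite /= ?addr0 ?add0r ?ler10.
Qed.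

Lemma measurable_loss d (T : measurableType d) (X : set T) (h k : T -> bool) :
  measurable X -> measurable_fun X h -> measurable_fun X k ->
  measurable_fun X (fun x => loss (h x) (k x) : R).
Proof.
move=> mX mh mk.
have mb : measurable_fun [set: bool] (fun b : bool => b%:R : R) by [].
rewrite (_ : (fun x => _) = (fun b : bool => b%:R : R) \o (fun x => h x != k x))//.
apply: measurableT_comp mb _; apply: measurable_neg.
rewrite (_ : (fun x => _) = fun x => if h x then k x else ~~ k x); last first.
  by apply/funext => x; case: (h x); case: (k x).
apply: measurable_fun_if => //; last apply: measurable_neg;
  by apply: measurable_funS mk => // x [].
Qed.

Lemma integrable_loss d (T : measurableType d) (F : probability T R)
    (X : set T) (h k : T -> bool) :
  measurable X -> measurable_fun X h -> measurable_fun X k ->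
  F.-integrable X (EFin \o (fun x => loss (h x) (k x))).
Proof.
move=> mX mh mk; apply: measurable_bounded_integrable => //.
- by rewrite (le_lt_trans (probability_le1 F mX))// ltry.
- exact: measurable_loss.
- exists 1; split=> // M M1 x _ /=; rewrite ger0_norm ?loss_ge0//.
  by apply: le_trans (ltW M1); rewrite /loss; case: (_ != _).
Qed.

End loss_lemmas.

(** * Splitting of the true and empirical risks *)

Section risk_lemmas.
Context {R : realType} {N : nat}.
Variables (X : set (Rn R N)) (F : probability (Rn R N) R).
Context {Theta : metricType R}.
Variable f : Theta -> Rn R N -> bool.

(** Off the null set [Z], [loss_split] applies pointwise to the labels [g y], [f t0 y], [f t y];
    integrating it gives the sum. *)
Lemma risk_split (g : Rn R N -> bool) (Z : set (Rn R N)) (t0 t : Theta) :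
  measurable X -> measurable_fun X g -> (forall u, measurable_fun X (f u)) ->
  F.-negligible Z ->
  (forall y, X y -> ~ Z y -> loss (f t0 y) (g y) <= loss (f t y) (g y) :> R) ->
  risk X F f g t = risk X F f g t0 + risk X F f (f t0) t.
Proof.
move=> mX mg mf Z0 better; rewrite /risk.
rewrite -RintegralD//; try exact: integrable_loss.
congr fine; apply: ae_eq_integral => //.
- by apply/measurable_EFinP; exact: measurable_loss.
- by apply/measurable_EFinP; apply: measurable_funD; exact: measurable_loss.
- apply: (@negligibleS _ _ _ F Z) Z0 => y /= /not_implyP[Xy ne].
  apply: contrapT => Zy; apply: ne; congr EFin.
  exact: loss_split (better _ Xy Zy).
Qed.

Lemma emp_risk_split (g : Rn R N -> bool) n (xs : n.-tuple (Rn R N))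
    (t0 t : Theta) :
  (forall i, loss (f t0 (tnth xs i)) (g (tnth xs i))
             <= loss (f t (tnth xs i)) (g (tnth xs i)) :> R) ->
  emp_risk f g xs t = emp_risk f g xs t0 + emp_risk f (f t0) xs t.
Proof.
move=> better; rewrite /emp_risk -mulrDr -big_split/=; congr (_ * _).
by apply: eq_bigr => i _; exact: loss_split.
Qed.

Lemma emp_risk_ge0 (h : Rn R N -> bool) n (xs : n.-tuple (Rn R N)) t :
  0 <= emp_risk f h xs t :> R.
Proof. by rewrite mulr_ge0 ?invr_ge0// sumr_ge0// => i _; exact: loss_ge0. Qed.

Lemma emp_risk_self n (xs : n.-tuple (Rn R N)) t :
  emp_risk f (f t) xs t = 0 :> R.
Proof.
rewrite /emp_risk big1 ?mulr0// => i _.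
by apply/eqP; rewrite loss_eq0.
Qed.

Lemma emp_risk_eq0 (h : Rn R N -> bool) n (xs : n.-tuple (Rn R N)) t :
  (0 < n)%N -> emp_risk f h xs t = 0 :> R ->
  forall i, f t (tnth xs i) = h (tnth xs i).
Proof.
move=> n0 /eqP; rewrite mulf_eq0 invr_eq0 pnatr_eq0 -leqn0 leqNgt n0/=.
rewrite psumr_eq0; last by move=> ? _; exact: loss_ge0.
by move=> /allP loss0 i; have := loss0 i (mem_index_enum i);
  rewrite /= loss_eq0 => /eqP.
Qed.

Lemma delta_max_lt (g : Rn R N -> bool) t0 (A0 : set Theta) (delta : R) t :
  (delta%:E < delta_max X F f g t0 A0)%E -> ~ A0 t ->
  delta < risk X F f g t - risk X F f g t0.
Proof.
rewrite lt_min => /andP[_ lt_inf] A0t; rewrite -lte_fin.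
by apply: lt_le_trans lt_inf _; apply: ereal_inf_lbound; exists t.
Qed.

(** * Comparison of the two ERMs on a fixed sample *)

Section sample_dichotomy.
Variables (g : Rn R N -> bool) (t0 : Theta) (A0 : set Theta) (delta : R).
Variables (n : nat) (xs : n.-tuple (Rn R N)).
Variables thg thf : n.-tuple (Rn R N) -> Theta.
Hypotheses (n_gt0 : (0 < n)%N) (Xxs : forall i, X (tnth xs i)).
Hypothesis ERMg : is_ERM X F f g thg.
Hypothesis ERMf : is_ERM X F f (f t0) thf.
Hypothesis risk_A0 : forall t, A0 t ->
  risk X F f g t = risk X F f g t0 + risk X F f (f t0) t.
Hypothesis emp_risk_A0 : forall t, A0 t ->
  emp_risk f g xs t = emp_risk f g xs t0 + emp_risk f (f t0) xs t.
Hypothesis risk_A0C : forall t, ~ A0 t ->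
  delta < risk X F f g t - risk X F f g t0.

(** The target [f t0] lies in the class, so the least empirical risk is 0, attained exactly by a
    perfect fit. *)
Lemma ERM_target_fit t : is_argmin (emp_risk f (f t0) xs) t <->
  forall i, f t (tnth xs i) = f t0 (tnth xs i).
Proof.
split=> [/(_ t0)|fit u]; last first.
  apply: le_trans (emp_risk_ge0 _ _ _).
  rewrite -(emp_risk_self xs t0) /emp_risk.
  by under eq_bigr do rewrite fit.
rewrite emp_risk_self => le0; apply: emp_risk_eq0 => //.
by apply/eqP; rewrite eq_le le0 emp_risk_ge0.
Qed.

(* If [thg] lands in [A0], then [t0] minimizes the empirical risk of [g], so
   [thg] and [thf] each minimize both empirical risks and the tie-breaking by
   the true risk compares them. *)
Lemma excess_risk_ERM :
  delta < risk X F f g (thg xs) - risk X F f g t0 <->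
  delta < risk X F f (f t0) (thf xs) \/ ~ A0 (thg xs).
Proof.
have [ming maxg] := ERMg Xxs; have [minf maxf] := ERMf Xxs.
split=> [|[ltf|]]; last exact: risk_A0C.
- have [A0g|] := pselect (A0 (thg xs)); last by right.
  rewrite risk_A0// addrC addKr => ltg; left; apply: lt_le_trans ltg _.
  apply: maxf => u; apply: le_trans (emp_risk_ge0 _ _ _).
  (* Since [thg] does no worse than [t0] for [g], the splitting forces its empirical risk for [f t0]
     to be at most 0. *)
  by have := ming t0; rewrite emp_risk_A0// gerDl.
- have [A0g|] := pselect (A0 (thg xs)); last exact: risk_A0C.
  have /maxg lefg : is_argmin (emp_risk f g xs) (thf xs).
    (* [thf] agrees with [t0] at every sample point, so for [g] it has the empirical risk of [t0],
       which the splitting bounds by that of [thg]. *)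
    move=> u; apply: le_trans (ming u).
    rewrite (emp_risk_A0 A0g) -[leLHS]addr0 lerD ?emp_risk_ge0//.
    move/ERM_target_fit : minf => fit.
    by rewrite /emp_risk; under eq_bigr do rewrite fit.
  apply: (@lt_le_trans _ _ (risk X F f g (thf xs) - risk X F f g t0)).
    (* [thf] may leave the region even when [thg] is in it; its excess risk then exceeds [delta] by
       the gap. *)
    have [A0f|] := pselect (A0 (thf xs)); last exact: risk_A0C.
    by rewrite risk_A0// addrC addKr.
  by rewrite lerD2r.
Qed.

End sample_dichotomy.

End risk_lemmas.

(** Each [x i] has law [F], so it pulls a null set back to a null event; the bad event lies in the
    countable union of these. *)
Lemma negligible_sample (R : realType) (N : nat) (F : probability (Rn R N) R)
    (d : measure_display) (Omega : measurableType d) (P : probability Omega R)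
    (x : nat -> {RV P >-> Rn R N}) (Z : set (Rn R N)) n :
  iid F x -> F.-negligible Z ->
  P.-negligible [set w | exists i : 'I_n, Z (tnth (sample x n w) i)].
Proof.
move=> [dist _] [B [mB B0 ZB]].
apply: (@negligibleS _ _ _ P (\bigcup_i (x i @^-1` B))).
  by move=> w [i]; rewrite tnth_mktuple => /ZB Bxi; exists i.
apply: negligible_bigcup => i; exists (x i @^-1` B); split=> //.
- by rewrite -[X in measurable X]setTI; exact: measurable_funP.
- by rewrite -B0 -(dist i B mB).
Qed.

(** The complement of the event behind [P_R] is [Rf <= delta], so conditioning on it gives an exact
    identity; the version with [<] is derived when [Rf = delta] has probability 0. *)
Theorem mainTheorem1
  (R : realType) (N : nat)
  (* feature space and distribution *)
  (X : set (Rn R N)) (mX : measurable X)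
  (F : probability (Rn R N) R) (FX : F X = 1%E)
  (lebF : charges_lebesgue_positive X F)
  (* hypothesis class and ground truth *)
  (Theta : metricType R) (f : Theta -> Rn R N -> bool)
  (mf : forall t, measurable_fun X (f t))
  (ndf : nondegenerate_class X F f)
  (g : Rn R N -> bool) (mg : measurable_fun X g)
  (* i.i.d. samples *)
  (d : measure_display) (Omega : measurableType d) (P : probability Omega R)
  (x : nat -> {RV P >-> Rn R N}) (iidx : iid F x)
  (* global optimum and regions *)
  (topt : Theta) (A : Theta -> set Theta) (regA : is_regions X F f g topt A)
  (* ERMs for the targets g and f_opt *)
  (thg thf : forall n, n.-tuple (Rn R N) -> Theta)
  (ERMg : forall n, (0 < n)%N -> is_ERM X F f g (@thg n))
  (ERMf : forall n, (0 < n)%N -> is_ERM X F f (f topt) (@thf n))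
  (* the quantities whose probabilities are considered are measurable *)
  (mdg : forall n,
    measurable_fun setT (fun w => mdist (thg n (sample x n w)) topt))
  (mrg : forall n,
    measurable_fun setT (fun w => risk X F f g (thg n (sample x n w))))
  (mrf : forall n,
    measurable_fun setT (fun w => risk X F f (f topt) (thf n (sample x n w))))
  (mAg : forall n, measurable [set w | A topt (thg n (sample x n w))])
  (nullA : common_null_set X F f g topt (A topt))
  (* (1) *) (stable_opt : stable_GLP X F f g topt)
  (* (2) *) (opt : is_argmin (risk X F f g) topt)
  (opt_uniq : forall t, is_argmin (risk X F f g) t -> t = topt)
  (* (3) *)
  (cvg_thg : cvg_in_probability P (fun n w => thg n (sample x n w)) topt)
  (* (4) *) (complF : complete_class X F f)
  (* (5) *) (delta : R) (delta_gt0 : 0 < delta)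
  (delta_lt : (delta%:E < delta_max X F f g topt (A topt))%E)
  (n : nat) (n_gt0 : (0 < n)%N) :
  let excess w := risk X F f g (thg n (sample x n w)) - risk X F f g topt in
  let Rf w := risk X F f (f topt) (thf n (sample x n w)) in
  let P_R := Pr P [set w | delta < Rf w] in
  let missed := [set w | ~ A topt (thg n (sample x n w))] in
  Pr P [set w | delta < excess w] =
    P_R + (1 - P_R) * cond_Pr P missed [set w | Rf w <= delta]
  /\
  (Pr P [set w | Rf w = delta] = 0 ->
   Pr P [set w | delta < excess w] =
     P_R + (1 - P_R) * cond_Pr P missed [set w | Rf w < delta]).
Proof.
move=> excess Rf P_R missed.
have mexcess : measurable_fun setT excess.
  by apply: measurable_funB => //; exact: mrg.
have mpre (h : Omega -> R) (S : set R) : measurable_fun setT h ->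
    measurable S -> measurable (h @^-1` S).
  by move=> mh mS; rewrite -[X in measurable X]setTI; exact: mh.
have mE : measurable [set w | delta < excess w].
  by rewrite (_ : mkset _ = excess @^-1` `]delta, +oo[);
    [exact: mpre|apply/seteqP; split=> w /=; rewrite in_itv/= andbT].
have mle : measurable [set w | Rf w <= delta].
  by rewrite (_ : mkset _ = Rf @^-1` `]-oo, delta]);
    [exact: mpre (mrf n) _|apply/seteqP; split=> w /=; rewrite in_itv].
have mlt : measurable [set w | Rf w < delta].
  by rewrite (_ : mkset _ = Rf @^-1` `]-oo, delta[);
    [exact: mpre (mrf n) _|apply/seteqP; split=> w /=; rewrite in_itv].
have meq : measurable [set w | Rf w = delta] by exact: (mpre _ [set delta] (mrf n)).
have mmissed : measurable missed by exact: measurableC (mAg n).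
have ltE : [set w | delta < Rf w] = ~` [set w | Rf w <= delta].
  by apply/seteqP; split=> w /=; rewrite ltNge => /negP.
have [Z Z0 betterZ] := nullA.
have XC0 : F.-negligible (~` X).
  exists (~` X); split=> //; first exact: measurableC.
  by apply: etrans (probability_setC F mX) _; rewrite FX subee.
have main : Pr P [set w | delta < excess w] =
    P_R + (1 - P_R) * cond_Pr P missed [set w | Rf w <= delta].
  rewrite /P_R ltE -Pr_setUC// -ltE.
  (* Off this null event every sample point lies in [X] and avoids [Z], so the empirical risk splits
     on the region. *)
  have negS := negligible_sample n iidx (negligibleU Z0 XC0).
  apply: (Pr_eq_ae negS) => //.
    by apply: measurableU => //; rewrite ltE; exact: measurableC.
  move=> w /forallNP/= good.
  have Xs i : X (tnth (sample x n w) i).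
    by apply: contrapT => nX; apply: (good i); right.
  have nZs i : ~ Z (tnth (sample x n w) i).
    by move=> Zi; apply: (good i); left.
  apply: (excess_risk_ERM n_gt0 Xs (ERMg _ n_gt0) (ERMf _ n_gt0)).
  - by move=> t At; apply: risk_split Z0 _ => // y Xy Zy; exact: betterZ.
  - by move=> t At; apply: emp_risk_split => i; exact: betterZ.
  - by move=> t; exact: delta_max_lt delta_lt.
split=> // eq0; rewrite main.
have eq_neg : P.-negligible [set w | Rf w = delta].
  exists [set w | Rf w = delta]; split=> //.
  by apply: etrans (esym (probability_fineK P meq)) _; rewrite eq0.
(* Replacing [<=] by [<] alters numerator and denominator only on the null event [Rf = delta]. *)
by congr (_ + _ * (_ / _)); apply: (Pr_eq_ae eq_neg) => //;
  try exact: measurableI; move=> w ne; rewrite /= lt_neqAle (introF eqP ne).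
Qed.
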